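(* Let $T$ be a fixed finite rooted tree with node set $V$. For $v\in V$ let $z_v$ be the number of nodes of the subtree rooted at $v$. Then $$I(T)\overset{d}{=}\sum_{v\in V} Z_v,$$ where $\{Z_v\}_{v\in V}$ are independent random variables and $Z_v$ is uniformly distributed on $\{0,1,\dots,z_v-1\}$ for each $v\in V$.
   Context: For nodes $u,v$ of a rooted tree with root $\rho$, write $u<v$ if $u$ is a proper ancestor of $v$, i.e. $u\ne v$ and the unique path from $\rho$ to $v$ passes through $u$. The subtree rooted at $v$ consists of $v$ and all its descendants. For a bijection $\lambda:V\to\{1,\dots,|V|\}$ let $I(T,\lambda)=\sum_{u<v}\mathbf 1_{\lambda(u)>\lambda(v)}$. The random variable $I(T)$ (number of inversions) is $I(T,\lambda)$ with $\lambda$ chosen uniformly at random among all bijections $V\to\{1,\dots,|V|\}$. The symbol $\overset{d}{=}$ denotes equality in distribution. *)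

(* Defs.v *)
From HB Require Import structures.
From mathcomp Require Import all_boot all_order all_algebra.
From mathcomp Require Import all_classical all_reals all_analysis.

Set Implicit Arguments.
Unset Strict Implicit.
Unset Printing Implicit Defensive.

Import Order.TTheory GRing.Theory Num.Theory.

Local Open Scope classical_set_scope.
Local Open Scope ring_scope.

(* A sequence of nodes of size at most 2 is not a cycle of a simple graph:
   [cycle e [:: x; y]] merely traverses one edge back and forth. *)
Definition acyclic (V : finType) (e : rel V) : Prop :=
  forall c : seq V, uniq c -> cycle e c -> (size c <= 2)%N.

Record is_tree (V : finType) (e : rel V) : Prop := IsTree {
  tree_sym : symmetric e;
  tree_irr : irreflexive e;
  tree_connected : forall u v : V, connect e u v;
  tree_acyclic : acyclic e
}.

(* [p] lists the nodes after [u] of a path without repeated nodes. *)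
Definition simple_path (V : finType) (e : rel V) (u v : V) (p : seq V) : Prop :=
  [/\ path e u p, uniq (u :: p) & last u p = v].

(* In a tree the simple path from [rho] to [v] exists and is unique, so "the
   path passes through [u]" is "some simple path passes through [u]". *)
Definition ancestor (V : finType) (e : rel V) (rho u v : V) : bool :=
  (u != v) &&
  `[< exists2 p : seq V, simple_path e rho v p & u \in rho :: p >].

Definition subtree (V : finType) (e : rel V) (rho v : V) : {set V} :=
  [set u | (u == v) || ancestor e rho v u].

Definition labelling (V : finType) : Type :=
  {f : {ffun V -> 'I_#|V|} | `[< bijective f >]}.

HB.instance Definition _ (V : finType) := Finite.on (labelling V).

Lemma enum_rank_labelling (V : finType) :
  `[< bijective [ffun v : V => enum_rank v] >].
Proof.
apply/asboolP; exists enum_val => x.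
  by rewrite ffunE enum_rankK.
by rewrite ffunE enum_valK.
Qed.

HB.instance Definition _ (V : finType) := isPointed.Build (labelling V)
  (exist (fun f : {ffun V -> 'I_#|V|} => `[< bijective f >])
    [ffun v => enum_rank v] (enum_rank_labelling V)).

HB.instance Definition _ (V : finType) := @isMeasurable.Build
  default_measure_display (labelling V) discrete_measurable
  discrete_measurable0 discrete_measurableC discrete_measurableU.

(* The labels are 1, ..., #|V|, while 'I_#|V| starts at 0. *)
Definition label (V : finType) (l : labelling V) (v : V) : nat := (\val l v).+1.

Definition inversions (V : finType) (e : rel V) (rho : V) (l : labelling V) :
    nat :=
  (\sum_(u : V) \sum_(v : V | ancestor e rho u v) (label l v < label l u)%N)%N.

(* The finite set is enumerated by [s], which must be free of repetitions. *)
Definition uniform_on d d' (Omega : measurableType d) (T : measurableType d')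
    (R : realType) (P : probability Omega R) (X : {RV P >-> T}) (s : seq T) :
    Prop :=
  forall x : T, P (X @^-1` [set x]) = ((x \in s)%:R / (size s)%:R)%:E.

Definition independent_RVs d d' (Omega : measurableType d)
    (T : measurableType d') (R : realType) (P : probability Omega R)
    (I : finType) (X : I -> {RV P >-> T}) : Prop :=
  forall (J : {set I}) (A : I -> set T),
    (forall i, i \in J -> measurable (A i)) ->
    P (\bigcap_(i in [set` J]) (X i @^-1` A i)) =
      (\prod_(i in J) P (X i @^-1` A i))%E.

Definition eq_in_distribution d1 d2 d' (Omega1 : measurableType d1)
    (Omega2 : measurableType d2) (T : measurableType d') (R : realType)
    (P1 : probability Omega1 R) (P2 : probability Omega2 R)
    (X1 : Omega1 -> T) (X2 : Omega2 -> T) : Prop :=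
  forall A : set T, measurable A -> P1 (X1 @^-1` A) = P2 (X2 @^-1` A).

(* Main.v *)
Require Import Defs.
From mathcomp Require Import all_boot all_order all_algebra perm.
From mathcomp Require Import all_classical all_reals all_analysis.
Import Order.TTheory GRing.Theory Num.Theory.

(** Charge every inversion to its upper node: [I(T, l)] is the sum over [u] of
    the number [D_u(l)] of descendants of [u] with a smaller label than [u]
    ([inversionsE]). Always [0 <= D_u < z_u], and the theorem follows from the
    stronger fact that the vector [(D_u)_u] is uniform on the box of the
    vectors satisfying these bounds, i.e. that all its fibres over the box have
    the same cardinality ([card_inversion_code]).

    To compare fibres, take a labelling with [D_u < z_u - 1], let [v] be the
    descendant of [u] carrying the next larger label within the subtree of [u],
    and exchange the labels of [u] and [v]. This raises [D_u] by one and keeps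
    all the other coordinates ([inversions_at_swap]): an ancestor of [u] sees
    the same set of labels below it, any other node is in the subtree of [u],
    where the relative order of the nodes other than [u] is preserved, or has a
    subtree disjoint from it. The exchange is injective ([swap_next_inj]), so
    fibres grow along the coordinatewise order of the box ([leq_fibre]). But
    reversing the order of the labels turns [D_u] into [z_u - 1 - D_u], so the
    fibres of the least and of the greatest vector are equally large, and
    everything in between is squeezed ([card_fibre]).

    On the probabilistic side, it is enough to show that the law of [I(T)] is
    dominated by that of the sum of the [Z_v] on every set of values: applied
    to a set and to its complement, this gives equality since both masses are
    one. Domination needs only the part of the sample space where
    [(Z_v)_v] lies in the box, on which independence gives every vector the
    mass [1 / \prod_v z_v] ([prob_inversions], [prob_sum_ge]). *)

(** * Ancestors in a tree *)

(** If two simple paths left [u] through distinct neighbours and met again, then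
    these neighbours would be joined avoiding [u], closing a cycle at [u]. *)
Lemma simple_path_unique {V : finType} {e : rel V} {u v : V} {p q : seq V} :
  is_tree e -> simple_path e u v p -> simple_path e u v q -> p = q.
Proof.
move=> [esym _ _ eacy].
elim: p q u => [|x p IHp] [|y q] u //=.
- move=> [_ _ /= <-] [_ /=/andP[uq _] lq].
  by move: uq; rewrite -lq mem_last.
- move=> [_ /=/andP[up _] lp] [_ _ /= uv].
  by move: up; rewrite uv -lp mem_last.
move=> [] /= /andP[eux px] /andP[up upx] lp.
move=> [] /= /andP[euy qy] /andP[uq uqy] lq.
have [xy|nxy] := eqVneq x y.
  by subst y; congr (_ :: _); apply: (IHp q x).
(* Going from x to v along p and back to y along q avoids u. *)
have back : path e v (rev (belast y q)).
  by rewrite -lq rev_path (eq_path (e' := e)).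
have lback : last v (rev (belast y q)) = y.
  by case: (q) lq => [|z r] //= _; rewrite rev_cons last_rcons.
have pxy : path e x (p ++ rev (belast y q)) by rewrite cat_path px lp.
have [s [ps us ls sub]] : exists s, [/\ path e x s, uniq (x :: s),
    last x s = y & {subset s <= p ++ rev (belast y q)}].
  have lxy : last x (p ++ rev (belast y q)) = y by rewrite last_cat lp lback.
  by case/shortenP: pxy lxy => s ps us sub ls; exists s; split=> // z /sub.
have us' : u \notin x :: s.
  rewrite inE negb_or; apply/andP; split.
    by move: up; rewrite inE negb_or => /andP[].
  apply/negP => /sub; rewrite mem_cat mem_rev => /orP[inp|/mem_belast inq].
    by move: up; rewrite inE inp orbT.
  by move: uq; rewrite inq.
have := eacy [:: u, x & s].
rewrite /= rcons_path eux ps ls esym euy => /(_ _ isT).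
rewrite -[_ && (_ && _)]/(uniq [:: u, x & s]) cons_uniq us' us => /(_ isT).
by case: s ls {ps us sub us'} => //= xy; rewrite xy eqxx in nxy.
Qed.

Lemma simple_path_exists {V : finType} {e : rel V} (u v : V) :
  is_tree e -> exists p, simple_path e u v p.
Proof.
case=> _ _ /(_ u v)/connectP[p pp ->] _.
by case/shortenP: pp => q pq uq _; exists q.
Qed.

(** By uniqueness, the path to [v] up to a node [u] on it is the path to [u], so
    ancestry becomes the prefix order on the paths from the root, which makes
    the order properties of ancestry immediate. *)
Lemma ancestor_prefix {V : finType} {e : rel V} {rho u v : V} {p q : seq V} :
  is_tree e -> simple_path e rho u p -> simple_path e rho v q ->
  ancestor e rho u v = (u != v) && prefix p q.
Proof.
move=> he sp sq; rewrite /ancestor; congr andb; apply/asboolP/prefixP.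
- move=> [q' sq' uq']; rewrite (simple_path_unique he sq' sq) in uq'.
  move: uq' sq {sq'} => /splitPl[p1 p2 lp1] [pq uq lq].
  exists p2; congr (_ ++ _); apply: (simple_path_unique he _ sp).
  split => //; first by move: pq; rewrite cat_path => /andP[].
  by move: uq; rewrite -cat_cons cat_uniq => /andP[].
- move=> [r qr]; exists q => //; case: sp => _ _ <-.
  by rewrite qr -cat_cons mem_cat mem_last.
Qed.

Lemma prefix_comparable {T : eqType} {s1 s2 s : seq T} :
  prefix s1 s -> prefix s2 s -> prefix s1 s2 || prefix s2 s1.
Proof.
elim: s s1 s2 => [|x s IHs] [|x1 s1] [|x2 s2] //=.
by move=> /andP[/eqP-> h1] /andP[/eqP-> h2]; rewrite !eqxx; apply: IHs.
Qed.

(** All that the count of labellings uses of a rooted tree; the last clause says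
    that the ancestors of a node form a chain. *)
Definition forest_order {V : eqType} (anc : rel V) : Prop :=
  [/\ irreflexive anc, transitive anc &
      forall u w v, anc u v -> anc w v -> [|| u == w, anc u w | anc w u]].

Lemma ancestor_forest_order {V : finType} {e : rel V} (rho : V) :
  is_tree e -> forest_order (ancestor e rho).
Proof.
move=> he.
have /choice[pth hpth] := fun u => simple_path_exists rho u he.
have ancE u v : ancestor e rho u v = (u != v) && prefix (pth u) (pth v).
  exact: ancestor_prefix he (hpth u) (hpth v).
have pth_inj : injective pth.
  by move=> u v uv; case: (hpth u) (hpth v) => _ _ <- [_ _ <-]; rewrite uv.
split=> [u|w u v|u w v]; rewrite !ancE ?eqxx //.
- move=> /andP[uw uw'] /andP[_ wv]; rewrite (prefix_trans uw' wv) andbT.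
  apply: contra_neq uw => uv; subst v; apply/pth_inj/eqP.
  by move: uw'; rewrite prefixE take_oversize ?(size_prefix wv) // eq_sym.
- move=> /andP[_ uv] /andP[_ wv]; rewrite (eq_sym w).
  by case: eqVneq => //= _; exact: prefix_comparable uv wv.
Qed.

(** * Operations on labellings *)

Lemma label_inj {V : finType} (l : labelling V) : injective (label l).
Proof.
move=> u v [/val_inj]; have := valP l; move/asboolP/bij_inj; exact.
Qed.

Lemma labelling_ext {V : finType} (l m : labelling V) :
  (forall v, label l v = label m v) -> l = m.
Proof.
by move=> lm; apply/val_inj/ffunP => v; apply/val_inj; case: (lm v).
Qed.

Lemma injective_labelling {V : finType} {f : {ffun V -> 'I_#|V|}} :
  injective f -> `[< bijective f >].
Proof. by move=> fI; apply/asboolP/inj_card_bij => //; rewrite card_ord. Qed.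

Lemma swap_injective {V : finType} (l : labelling V) (u v : V) :
  injective [ffun w => \val l (tperm u v w)].
Proof.
move=> x y; rewrite !ffunE => lxy; apply: (@perm_inj _ (tperm u v)).
by apply: (label_inj l); rewrite /label lxy.
Qed.

Definition swap {V : finType} (l : labelling V) (u v : V) : labelling V :=
  exist (fun f : {ffun V -> 'I_#|V|} => `[< bijective f >]) _
    (injective_labelling (swap_injective l u v)).

Lemma label_swap {V : finType} (l : labelling V) (u v w : V) :
  label (swap l u v) w = label l (tperm u v w).
Proof. by rewrite /label /= ffunE. Qed.

Lemma swapK {V : finType} (l : labelling V) (u v : V) :
  swap (swap l u v) u v = l.
Proof. by apply: labelling_ext => w; rewrite !label_swap tpermK. Qed.

Lemma reverse_injective {V : finType} (l : labelling V) :
  injective [ffun w => rev_ord (\val l w)].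
Proof.
move=> x y; rewrite !ffunE => /rev_ord_inj lxy.
by apply: (label_inj l); rewrite /label lxy.
Qed.

Definition reverse {V : finType} (l : labelling V) : labelling V :=
  exist (fun f : {ffun V -> 'I_#|V|} => `[< bijective f >]) _
    (injective_labelling (reverse_injective l)).

Lemma label_reverse {V : finType} (l : labelling V) (v : V) :
  label (reverse l) v = #|V|.+1 - label l v.
Proof. by rewrite /label /= ffunE /= subSS subnSK. Qed.

Lemma ltn_label_reverse {V : finType} (l : labelling V) (u v : V) :
  (label (reverse l) u < label (reverse l) v) = (label l v < label l u).
Proof.
rewrite !label_reverse ltn_sub2lE // /label ltnS; exact/ltnW/ltn_ord.
Qed.

Lemma reverse_inj {V : finType} : injective (@reverse V).
Proof.
move=> l m lm; apply: labelling_ext => v; rewrite /label.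
have /(congr1 (fun f : {ffun V -> 'I_#|V|} => f v)) := congr1 val lm.
by rewrite /= !ffunE => /rev_ord_inj ->.
Qed.

(** * Exchanging a node with its successor in its subtree *)

Definition descendants {V : finType} (anc : rel V) (u : V) : {set V} :=
  [set v | anc u v].

Definition inversions_at {V : finType} (anc : rel V) (l : labelling V) (u : V) :
    nat :=
  #|[set v | anc u v & label l v < label l u]|.

(** Reversal exchanges the descendants with smaller and with larger label. *)
Lemma inversions_at_reverse {V : finType} (anc : rel V) (l : labelling V) u :
  irreflexive anc ->
  inversions_at anc (reverse l) u + inversions_at anc l u =
  #|descendants anc u|.
Proof.
move=> irr; rewrite addnC.
rewrite -(cardsID [set v | label l v < label l u] (descendants anc u)).
congr (_ + _); apply: eq_card => v; rewrite !inE //.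
rewrite ltn_label_reverse andbC -leqNgt; rewrite ltn_neqAle.
have [uv|] := boolP (anc u v); rewrite ?andbF // !andbT.
case: eqP => // /label_inj uv'.
by rewrite uv' irr in uv.
Qed.

Definition next_descendant {V : finType} (anc : rel V) (l : labelling V)
    (u v : V) : Prop :=
  [/\ anc u v, label l u < label l v & forall w, anc u w ->
      label l u < label l w -> label l v <= label l w].

Lemma next_descendant_exists {V : finType} {anc : rel V} {l : labelling V}
    {u : V} :
  irreflexive anc -> inversions_at anc l u < #|descendants anc u| ->
  exists v, next_descendant anc l u v.
Proof.
move=> irr; rewrite -(inversions_at_reverse anc l u) // -[ltnLHS]add0n.
rewrite ltn_add2r card_gt0 => /set0Pn[v0]; rewrite inE ltn_label_reverse => v0P.
pose P w := anc u w && (label l u < label l w).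
case: (@arg_minnP _ v0 P (label l) v0P) => v /andP[uv luv] vmin.
by exists v; split=> // w uw luw; apply: vmin; rewrite /P uw.
Qed.

(** No label of the subtree of [u] lies strictly between those of [u] and [v],
    so replacing one by the other changes no comparison with a third node of
    this subtree: there, only the comparison of [u] with [v] is affected. From
    above [u], the exchange merely permutes the labels found below. *)
Lemma inversions_at_swap {V : finType} {anc : rel V} {l : labelling V}
    {u v : V} (w : V) :
  forest_order anc -> next_descendant anc l u v ->
  inversions_at anc (swap l u v) w = (w == u) + inversions_at anc l w.
Proof.
move=> [irr tr cmp] [uv luv vmin].
have between x : anc u x -> x != v ->
    (label l x < label l v) = (label l x < label l u).
  move=> ux xv; apply/idP/idP => [lxv|/ltn_trans]; last exact.
  rewrite ltnNge leq_eqVlt negb_or; apply/andP; split.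
    by apply: contraTneq ux => /label_inj ->; rewrite irr.
  by apply/negP => /(vmin _ ux); rewrite leqNgt lxv.
have between' x : anc u x -> x != v ->
    (label l v < label l x) = (label l u < label l x).
  move=> ux xv; rewrite [LHS]ltnNge [RHS]ltnNge; congr negb.
  rewrite [LHS]leq_eqVlt [RHS]leq_eqVlt between //; congr orb.
  have xu : x != u by apply: contraTneq ux => ->; rewrite irr.
  by rewrite !(inj_eq (label_inj l)) (negPf xu) (negPf xv).
have [->|wu] := eqVneq w u.
  (* The node v joins the descendants of u with a smaller label. *)
  rewrite /inversions_at (cardsD1 v) inE uv !label_swap tpermL tpermR luv /=.
  congr (1 + _); apply: eq_card => x; rewrite !inE !label_swap.
  have [->|xv] /= := eqVneq x v; first by rewrite ltnNge (ltnW luv) andbF.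
  case: (boolP (anc u x)) => //= ux.
  have xu : u != x by apply: contraTneq ux => <-; rewrite irr.
  by rewrite tpermD ?between // eq_sym.
rewrite add0n /inversions_at.
have [wanc|wanc] := boolP (anc w u).
  (* An ancestor of u is one of v, and sees the same labels below it. *)
  have wv := tr _ _ _ wanc uv.
  have wv' : w != v by apply: contraTneq wv => ->; rewrite irr.
  rewrite -[RHS](card_preimset _ (@perm_inj _ (tperm u v))).
  apply: eq_card => x; rewrite !inE !label_swap.
  rewrite (tpermD (z := w)) 1?eq_sym //; congr andb.
  by case: tpermP => [->|->|]; rewrite ?wanc ?wv.
(* Now w does not lie above u, and only its comparisons with v may change. *)
apply: eq_card => x; rewrite !inE !label_swap.
case: (boolP (anc w x)) => //= wx.
have xu : u != x by apply: contraNneq wanc => ->.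
have [wv|wv] := eqVneq w v.
  subst w; rewrite tpermR.
  have xv : x != v by apply: contraTneq wx => ->; rewrite irr.
  by rewrite tpermD 1?[v == x]eq_sym // between // (tr _ _ _ uv wx).
rewrite (tpermD (z := w)) 1?eq_sym //.
have [xv|xv] := eqVneq x v; last by rewrite tpermD // eq_sym.
subst x; rewrite tpermR -between' //.
(* As w and u are both ancestors of v, they are comparable. *)
by have := cmp _ _ _ uv wx; rewrite eq_sym (negPf wu) (negPf wanc) orbF.
Qed.

(** After the exchange, [v] precedes [u] immediately in the subtree of [u]; this
    is how [v] is recovered from the result. *)
Lemma next_descendant_swap {V : finType} {anc : rel V} {l : labelling V}
    {u v : V} (w : V) :
  next_descendant anc l u v -> anc u w ->
  label (swap l u v) w < label (swap l u v) u ->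
  label (swap l u v) w <= label (swap l u v) v.
Proof.
move=> [uv luv vmin] uw; rewrite !label_swap tpermL tpermR.
case: tpermP => [_|_|_ _ lwv]; rewrite ?ltnn //.
by rewrite leqNgt; apply/negP => /(vmin _ uw); rewrite leqNgt lwv.
Qed.

Lemma swap_next_inj {V : finType} {anc : rel V} {l1 l2 : labelling V}
    {u v1 v2 : V} :
  next_descendant anc l1 u v1 -> next_descendant anc l2 u v2 ->
  swap l1 u v1 = swap l2 u v2 -> l1 = l2.
Proof.
move=> n1 n2 eqs.
have [[uv1 lt1 _] [uv2 lt2 _]] := (n1, n2).
have v12 : v1 = v2.
  apply: (label_inj (swap l1 u v1)); apply/eqP; rewrite eqn_leq.
  rewrite (next_descendant_swap v2 n1 uv2) ?andbT.
    rewrite eqs (next_descendant_swap v1 n2 uv1) // -eqs.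
    by rewrite !label_swap tpermL tpermR.
  by rewrite eqs !label_swap tpermL tpermR.
by rewrite -(swapK l1 u v1) eqs -v12 swapK.
Qed.

(** * Equidistribution of the local inversion numbers *)

Definition fibre {V : finType} (anc : rel V) (x : V -> nat) :
    {set labelling V} :=
  [set l | [forall u, inversions_at anc l u == x u]].

Lemma fibreP {V : finType} {anc : rel V} {x : V -> nat} {l : labelling V} :
  reflect (forall u, inversions_at anc l u = x u) (l \in fibre anc x).
Proof. by rewrite inE; apply: 'forall_eqP. Qed.

Lemma leq_fibre_incr {V : finType} {anc : rel V} {x : V -> nat} {u : V} :
  forest_order anc -> x u < #|descendants anc u| ->
  #|fibre anc x| <= #|fibre anc (fun w => (w == u) + x w)|.
Proof.
move=> fo xu; have [irr _ _] := fo.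
have ex l : exists v, l \in fibre anc x -> next_descendant anc l u v.
  have [/fibreP lx|] := boolP (l \in _); last by exists u.
  have [||v nv] := @next_descendant_exists _ anc l u; rewrite ?lx //.
  by exists v.
have [nxt nxtP] := choice ex.
rewrite -(card_in_imset (f := fun l => swap l u (nxt l))); last first.
  by move=> l m lx mx; apply: swap_next_inj (nxtP l lx) (nxtP m mx).
apply/subset_leq_card/fintype.subsetP => _ /imsetP[l lx ->].
by apply/fibreP => w; rewrite inversions_at_swap ?(fibreP lx) //; exact: nxtP.
Qed.

(** Any two comparable vectors of the box are joined by unit increments. *)
Lemma leq_fibre {V : finType} {anc : rel V} (x y : V -> nat) :
  forest_order anc -> (forall u, x u <= y u) ->
  (forall u, y u <= #|descendants anc u|) ->
  #|fibre anc x| <= #|fibre anc y|.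
Proof.
move=> fo; have [n] := ubnP (\sum_u (y u - x u)).
elim: n x => // n IHn x lt_n xy yd.
have [/forallP yx|/forallPn[u]] := boolP [forall u, y u <= x u].
  rewrite (_ : x = y) //; apply/funext => u.
  by apply/eqP; rewrite eqn_leq xy yx.
rewrite -ltnNge => xyu; apply: leq_trans (leq_fibre_incr (u := u) fo _) _.
  exact: leq_trans (yd u).
apply: IHn => // [|w]; last by case: eqVneq => [->|_]; rewrite ?add1n ?add0n.
rewrite ltnS in lt_n; apply: leq_trans lt_n.
rewrite (bigD1 u) // [ltnRHS](bigD1 u) //= eqxx -addSn leq_add //.
  by rewrite subnS prednK ?subn_gt0.
by apply: leq_sum => w /negPf ->.
Qed.

(** The fibre of [x] is squeezed between those of the least and the greatest
    vector, which reversal of the labels puts in bijection. *)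
Lemma card_fibre {V : finType} {anc : rel V} (x : V -> nat) :
  forest_order anc -> (forall u, x u <= #|descendants anc u|) ->
  #|fibre anc x| = #|fibre anc (fun=> 0)|.
Proof.
move=> fo xd; apply/eqP; rewrite eqn_leq (leq_fibre (fun=> 0)) // andbT.
apply: leq_trans (leq_fibre x (fun u => #|descendants anc u|) _ _ _) _ => //.
have [irr _ _] := fo.
rewrite -(card_imset _ reverse_inj).
apply/subset_leq_card/fintype.subsetP => _ /imsetP[l /fibreP lx ->].
apply/fibreP => u; apply/eqP; rewrite -(eqn_add2r (inversions_at anc l u)).
by rewrite inversions_at_reverse // lx.
Qed.

Lemma inversions_at_leq {V : finType} (anc : rel V) (l : labelling V) (u : V) :
  inversions_at anc l u <= #|descendants anc u|.
Proof.
by apply/subset_leq_card/fintype.subsetP => v; rewrite !inE => /andP[].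
Qed.

Lemma inversions_at_max {V : finType} (anc : rel V) (l : labelling V) (u : V) :
  inversions_at anc l u < #|V|.
Proof.
rewrite -cardsT; apply/proper_card/properP; split; first exact: finset.subsetT.
by exists u => //; rewrite inE ltnn andbF.
Qed.

(** The vector of local inversion numbers as an element of a finite type: the
    common bound [#|V|] exceeds each of them. *)
Definition inversion_code {V : finType} (anc : rel V) (l : labelling V) :
    {ffun V -> 'I_#|V|} :=
  [ffun u => Ordinal (inversions_at_max anc l u)].

Definition code_box {V : finType} (anc : rel V) : {set {ffun V -> 'I_#|V|}} :=
  [set f : {ffun V -> 'I_#|V|} | [forall u, f u <= #|descendants anc u|]].

Lemma inversion_code_in {V : finType} (anc : rel V) (l : labelling V) :
  inversion_code anc l \in code_box anc.
Proof. by rewrite inE; apply/forallP => u; rewrite ffunE inversions_at_leq. Qed.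

Lemma descendants_max {V : finType} (anc : rel V) (u : V) :
  irreflexive anc -> #|descendants anc u| < #|V|.
Proof.
move=> irr; rewrite -cardsT; apply/proper_card/properP; split.
  exact: finset.subsetT.
by exists u => //; rewrite inE irr.
Qed.

Lemma card_code_box {V : finType} (anc : rel V) :
  irreflexive anc ->
  #|code_box anc| = \prod_u #|descendants anc u|.+1.
Proof.
move=> irr.
pose F u := [pred k : 'I_#|V| | k <= #|descendants anc u|].
rewrite (_ : #|code_box anc| = #|family F|); last first.
  by apply: eq_card => f; rewrite inE; apply/forallP/familyP.
rewrite card_family foldrE big_map big_enum /=; apply: eq_bigr => u _.
transitivity (\sum_(k < #|descendants anc u|.+1) 1).
  2: by rewrite sum1_card card_ord.
rewrite (big_ord_widen _ (fun=> 1) (descendants_max anc u irr)) -[LHS]sum1_card.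
exact: eq_bigl.
Qed.

(** The labellings split into equally large fibres indexed by the box. *)
Lemma card_inversion_code {V : finType} {anc : rel V} f :
  forest_order anc -> f \in code_box anc ->
  #|[set l | inversion_code anc l == f]| * \prod_u #|descendants anc u|.+1 =
  #|{: labelling V}|.
Proof.
move=> fo; have [irr _ _] := fo; rewrite -card_code_box //.
have card_code g : g \in code_box anc ->
    #|[set l | inversion_code anc l == g]| = #|fibre anc (fun=> 0)|.
  rewrite inE => /forallP gd.
  rewrite -(card_fibre (fun u => val (g u))) //; apply: eq_card => l.
  rewrite [LHS]inE; apply/eqP/fibreP => [<- u|gl]; first by rewrite ffunE.
  by apply/ffunP => u; apply/val_inj; rewrite ffunE /= gl.
move=> /card_code ->; rewrite -[RHS]sum1_card.
rewrite (partition_big (inversion_code anc) (mem (code_box anc))) /=.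
  rewrite mulnC -sum_nat_const; apply: eq_bigr => g /card_code <-.
  by rewrite -sum1dep_card.
by move=> l _; exact: inversion_code_in.
Qed.

(** * The two distributions *)

(** Finite vectors of naturals are countable, and a condition on the sum splits
    into the events fixing all the coordinates. *)
Lemma measurable_preimage_sum {d : measure_display} {T : measurableType d}
    {V : finType} (Z : V -> T -> nat) (B : set nat) :
  (forall v k, measurable (Z v @^-1` [set k])%classic) ->
  measurable ((fun w => (\sum_v Z v w)%N) @^-1` B)%classic.
Proof.
move=> mZ.
pose F (f : {ffun V -> nat}) :=
  (\bigcap_(v in [set: V]) (Z v @^-1` [set f v]))%classic.
have mF f : measurable (F f).
  by apply: fin_bigcap_measurable => // v _; exact: mZ.
have FE w f : F f w -> (\sum_v Z v w = \sum_v f v)%N.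
  by move=> fw; apply: eq_bigr => v _; exact: fw.
rewrite (_ : (_ @^-1` _)%classic =
    (\bigcup_(f in [set f : {ffun V -> nat} | B (\sum_v f v)%N]) F f)%classic).
  rewrite bigcup_mkcond; apply: countable_bigcupT_measurable => // f.
  by case: ifP.
apply/seteqP; split=> [w Bw|w [f Bf fw]]; last by rewrite /preimage /= (FE w f).
have Fw : F [ffun v => Z v w] w by move=> v _ /=; rewrite ffunE.
by exists [ffun v => Z v w] => //=; rewrite -(FE w).
Qed.

Lemma measure_bigcup_finset {d : measure_display} {T : measurableType d}
    {R : realType} (P : {measure set T -> \bar R}%R) {I : finType} (B : {set I})
    (F : I -> set T) :
  (forall i, measurable (F i)) -> trivIset [set: I]%classic F ->
  P (\bigcup_(i in [set` B]) F i)%classic = (\sum_(i in B) P (F i))%E.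
Proof.
move=> mF tF; have -> : [set` B]%classic = [set` enum B]%classic.
  by apply/seteqP; split=> i /=; rewrite mem_enum.
rewrite measure_fin_bigcup //.
  by rewrite -fsbig_seq ?enum_uniq // big_enum.
exact: sub_trivIset tF.
Qed.

Lemma inversionsE {V : finType} (e : rel V) (rho : V) (l : labelling V) :
  inversions e rho l = \sum_u inversions_at (ancestor e rho) l u.
Proof.
apply: eq_bigr => u _; rewrite -big_mkcondr /= sum1dep_card.
by apply: eq_card => v; rewrite !inE.
Qed.

Lemma card_subtree {V : finType} (e : rel V) (rho v : V) :
  #|subtree e rho v| = #|descendants (ancestor e rho) v|.+1.
Proof.
rewrite (cardsD1 v) inE eqxx add1n; congr _.+1; apply: eq_card => u.
rewrite !inE; case: eqVneq => //= ->.
by rewrite /ancestor eqxx.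
Qed.

Definition codes_summing_in {V : finType} (anc : rel V) (A : set nat) :
    {set {ffun V -> 'I_#|V|}} :=
  [set f in code_box anc | `[< A (\sum_v f v) >]].

Lemma prob_inversions {R : realType} {V : finType} {e : rel V} {rho : V}
    {d : measure_display} {Omega : measurableType d}
    {P : probability Omega R} {lambda : {RV P >-> labelling V}} (A : set nat) :
  is_tree e -> uniform_on lambda (enum {: labelling V}) ->
  P ((fun w => inversions e rho (lambda w)) @^-1` A)%classic =
  (\sum_(f in codes_summing_in (ancestor e rho) A)
    ((\prod_v (#|subtree e rho v|%:R : R))^-1)%R%:E)%E.
Proof.
move=> he unif; set anc := ancestor e rho.
have fo : forest_order anc := ancestor_forest_order rho he.
pose B := [set l : labelling V | `[< A (inversions e rho l) >]].
rewrite (_ : (_ @^-1` A)%classic =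
    (\bigcup_(l in [set` B]) (lambda @^-1` [set l]))%classic); last first.
  apply/seteqP; split=> [w Aw|w [l /=]].
    by exists (lambda w) => //=; rewrite inE; apply/asboolP.
  by rewrite inE => /asboolP Al ->.
rewrite measure_bigcup_finset; last 2 first.
- by move=> l; rewrite -[X in measurable X]setTI; exact: measurable_funP.
- exact: trivIset_preimage1.
rewrite (eq_bigr (fun=> ((#|{: labelling V}|%:R)^-1)%R%:E%E)); last first.
  by move=> l _; apply: etrans (unif l) _; rewrite mem_enum inE /= -cardE div1r.
rewrite (partition_big (inversion_code anc) (mem (codes_summing_in anc A))) /=.
  apply: eq_bigr => f; rewrite inE => /andP[fb fA].
  rewrite (eq_bigl (mem [set l | inversion_code anc l == f])); last first.
    move=> l; rewrite !inE andbC; case: eqP => //= lf; rewrite -[RHS]fA.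
    congr `[< A _ >]; rewrite inversionsE -lf.
    by apply: eq_bigr => v _; rewrite ffunE.
  rewrite sumEFin sumr_const; congr EFin.
  have lab_gt0 : 0 < #|{: labelling V}|.
    by apply/card_gt0P; exists (point : labelling V).
  rewrite -natr_prod (eq_bigr _ (fun v _ => card_subtree e rho v)).
  move: lab_gt0; rewrite -(card_inversion_code f fo fb) muln_gt0.
  move=> /andP[fib_gt0 _]; rewrite natrM invfM -[LHS]mulr_natr mulrAC.
  rewrite mulVf ?mul1r //.
  by rewrite pnatr_eq0 -lt0n.
move=> l; rewrite inE => /asboolP Al; rewrite inE inversion_code_in /=.
apply/asboolP; move: Al; rewrite inversionsE; congr A.
by apply: eq_bigr => v _; rewrite ffunE.
Qed.

(** An inequality is enough for the theorem, and spares showing that almost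
    surely no [Z v] leaves its range. *)
Lemma prob_sum_ge {R : realType} {V : finType} {e : rel V} {rho : V}
    {d : measure_display} {Omega : measurableType d}
    {P : probability Omega R} {Z : V -> {RV P >-> nat}} (A : set nat) :
  independent_RVs Z ->
  (forall v : V, uniform_on (Z v) (iota 0 #|subtree e rho v|)) ->
  (\sum_(f in codes_summing_in (ancestor e rho) A)
    ((\prod_v (#|subtree e rho v|%:R : R))^-1)%R%:E <=
  P ((fun w => (\sum_v Z v w)%N) @^-1` A)%classic)%E.
Proof.
move=> indep unif; set anc := ancestor e rho.
have mZ v k : measurable (Z v @^-1` [set k])%classic.
  exact: measurable_funPTI.
pose F (f : {ffun V -> 'I_#|V|}) :=
  (\bigcap_(v in [set: V]) (Z v @^-1` [set val (f v)]))%classic.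
have mF f : measurable (F f).
  by apply: fin_bigcap_measurable => // v _; exact: mZ.
have PF f : f \in codes_summing_in anc A ->
    P (F f) = ((\prod_v (#|subtree e rho v|%:R : R))^-1)%R%:E%E.
  rewrite !inE => /andP[/forallP fb _].
  have := indep [set: V]%SET (fun v => [set val (f v)]%classic) (fun _ _ => I).
  rewrite (_ : (\bigcap_(i in _) _)%classic = F f); last first.
    by apply/seteqP; split=> w wf v _; apply: wf => //=; rewrite inE.
  move=> ->; rewrite (eq_bigr (fun v => ((#|subtree e rho v|%:R)^-1)%R%:E%E)).
    rewrite prodEFin prodfV; congr (_^-1)%R%:E%E.
    by apply: eq_bigl => v; rewrite inE.
  move=> v _; apply: etrans (unif v _) _.
  by rewrite mem_iota size_iota card_subtree ltnS fb div1r.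
rewrite -(eq_bigr _ PF) -measure_bigcup_finset //; last first.
  move=> f g _ _ [w [fw gw]]; apply/ffunP => v; apply/val_inj.
  by rewrite -(fw v I) (gw v I).
apply: le_measure; rewrite ?inE.
- by apply: fin_bigcup_measurable => // f _; exact: mF.
- exact: measurable_preimage_sum.
- move=> w [f /=]; rewrite !inE => /andP[_ /asboolP Af] fw.
  rewrite (eq_bigr (fun v => nat_of_ord (f v))) // => v _; exact: fw.
Qed.

(** * Equality of the distributions *)

Theorem lemma1p1 (R : realType) (V : finType) (e : rel V) (rho : V)
    (he : is_tree e)
    (d1 : measure_display) (Omega1 : measurableType d1)
    (P1 : probability Omega1 R) (lambda : {RV P1 >-> labelling V})
    (hlambda : uniform_on lambda (enum {: labelling V}))
    (d2 : measure_display) (Omega2 : measurableType d2)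
    (P2 : probability Omega2 R) (Z : V -> {RV P2 >-> nat})
    (hZ_indep : independent_RVs Z)
    (hZ_unif : forall v : V, uniform_on (Z v) (iota 0 #|subtree e rho v|)) :
  eq_in_distribution P1 P2
    (fun w => inversions e rho (lambda w))
    (fun w => (\sum_(v : V) Z v w)%N).
Proof.
have le B : (P1 ((fun w => inversions e rho (lambda w)) @^-1` B)%classic <=
    P2 ((fun w => (\sum_(v : V) Z v w)%N) @^-1` B)%classic)%E.
  by rewrite (prob_inversions _ he hlambda) prob_sum_ge.
move=> A _; set I1 := (_ @^-1` A)%classic; set S2 := (_ @^-1` A)%classic.
have mI1 : measurable I1.
  exact: (measurable_funPTI lambda (Y := (inversions e rho @^-1` A)%classic)).
have mS2 : measurable S2.
  by apply: measurable_preimage_sum => v k; exact: measurable_funPTI.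
(* The domination on the complement of A is the reverse inequality on A. *)
have leC : (P1 (~` I1)%classic <= P2 (~` S2)%classic)%E := le (~` A)%classic.
rewrite (probability_setC P1 mI1) (probability_setC P2 mS2) in leC.
apply/eqP; rewrite eq_le le /=.
by move: leC; rewrite leeD2lE // leeN2.
Qed.
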